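(* Suppose $\mathbb K$ is a computable age with the amalgamation property (AP). Then $\mathbb K$ has the $\mathscr{EI}(\mathbb K)$-computable amalgamation property; that is, there is a function, computable from the embedding information $\mathscr{EI}(\mathbb K)$, which maps each potential span in $\mathbb K$ to an amalgamation diagram over it.
   Context: Languages and structures. $\mathcal{L}$ is a countable language (relation symbols of positive arity; function symbols of any arity, 0-ary ones being constants) with a computable representation: relation symbols $R_n$ and function symbols $F_m$ are indexed bijectively by disjoint computable subsets of $\omega$, with arity computable from the index. An $\mathcal{L}$-structure $\mathcal{M}$ is c.e. if its underlying set $M$ is a c.e. subset of $\omega$ and the sets $\{(n,\mathbf a): \mathcal M\models R_n(\mathbf a)\}$, $\{(n,\mathbf a): \mathcal M\models \neg R_n(\mathbf a)\}$, $\{(m,\mathbf a,b): \mathcal M\models F_m(\mathbf a)=b\}$ are c.e.; it is computable if moreover $M$ is computable. Tuples are finite; $\mathrm{cl}_{\mathcal M}(\mathbf a)$ is the smallest substructure of $\mathcal M$ containing $\mathbf a$. For $\mathbf a\in\mathcal A$, $\mathbf b\in\mathcal B$ of the same length, $\mathbf a\simeq\mathbf b$ means that for every atomic $\mathcal L$-formula $\varphi$, $\mathcal A\models\varphi(\mathbf a)$ iff $\mathcal B\models\varphi(\mathbf b)$; equivalently $\mathbf a\mapsto\mathbf b$ extends to an isomorphism $\mathrm{cl}(\mathbf a)\to\mathrm{cl}(\mathbf b)$. Ages. An age is a collection of finitely generated $\mathcal L$-structures closed under isomorphism. A computable age (computable representation of an age $\mathcal K$) is a c.e. set $\mathbb K$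 of triples $(\mathbf a,\mathcal A,i)$ (computable structures being given by indices), with exactly one triple for each $i\in\omega$, written $\mathbb I(i)=(\mathbf a_i,\mathcal A_i,i)$, such that each $\mathcal A_i$ is a computable $\mathcal L$-structure in $\mathcal K$ with $\mathcal A_i=\mathrm{cl}_{\mathcal A_i}(\mathbf a_i)$, and every $\mathcal B\in\mathcal K$ is isomorphic to some $\mathcal A_i$. $\mathbb K$ is said to have a property of ages if $\mathcal K$ does. The embedding information $\mathscr{EI}(\mathbb K)$ is the set of tuples $(\mathbb I(k_0),\mathbf b_0,\mathbb I(k_1),\mathbf b_1)$ with $\mathbf b_0\in\mathcal A_{k_0}$, $\mathbf b_1\in\mathcal A_{k_1}$ and $\mathbf b_0\simeq\mathbf b_1$. (AP): for all $\mathcal A,\mathcal B,\mathcal C\in\mathcal K$ and embeddings $f_{\mathcal B}:\mathcal A\to\mathcal B$, $f_{\mathcal C}:\mathcal A\to\mathcal C$ there are $\mathcal D\in\mathcal K$ and embeddings $\alpha_{\mathcal B}:\mathcal B\to\mathcal D$, $\alpha_{\mathcal C}:\mathcal C\to\mathcal D$ with $\alpha_{\mathcal B}\circ f_{\mathcal B}=\alpha_{\mathcal C}\circ f_{\mathcal C}$. Embeddings and amalgamation diagrams. A potential embedding in $\mathbb K$ is a triple $F=(\mathbb I(i),\mathbb I(j),\mathbf c)$ with $\mathbf c\in\mathcal A_j$; $\mathrm{dom}(F)=\mathbb I(i)$, $\mathrm{codom}(F)=\mathbb I(j)$. It is an embedding if $\mathbf a_i\simeq\mathbf c$ (it then encodes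 the embedding $\mathcal A_i\to\mathcal A_j$ sending $\mathbf a_i$ to $\mathbf c$); composition of embeddings is composition of the encoded maps. A potential span is a pair $(F_0,F_1)$ of potential embeddings with $\mathrm{dom}(F_0)=\mathrm{dom}(F_1)$; it is a span if both are embeddings. An amalgamation diagram over a potential span $(F_0,F_1)$ is a pair $(G_0,G_1)$ with $G_0$ an embedding, $G_1$ a potential embedding, $\mathrm{dom}(G_i)=\mathrm{codom}(F_i)$ for $i\in\{0,1\}$, $\mathrm{codom}(G_0)=\mathrm{codom}(G_1)$, and such that if $(F_0,F_1)$ is a span then $G_1$ is an embedding and $G_0\circ F_0=G_1\circ F_1$. *)

(* Defs.v *)
From mathcomp Require Import all_boot.
From Stdlib Require List Cantor.

Set Implicit Arguments.
Unset Strict Implicit.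
Unset Printing Implicit Defensive.

Definition pr (x y : nat) : nat := Cantor.to_nat (x, y).

Fixpoint code_seq (s : seq nat) : nat :=
  if s is x :: s' then (pr x (code_seq s')).+1 else 0.

(* Programs for the unary partial functions that are recursive in an oracle.
   Functions of several arguments read them from a single paired input. *)
Inductive prog : Type :=
  | Zero | Succ | Fst | Snd | Oracle
  | Pair of prog & prog
  | Comp of prog & prog
  | Prec of prog & prog
  | Mu of prog.

(* [eval X p n m]: with oracle the characteristic function of [X], program [p]
   halts on input [n] with output [m]. *)
Inductive eval (X : nat -> Prop) : prog -> nat -> nat -> Prop :=
  | eval_zero n : eval X Zero n 0
  | eval_succ n : eval X Succ n n.+1
  | eval_fst x y : eval X Fst (pr x y) x
  | eval_snd x y : eval X Snd (pr x y) y
  | eval_oracle_in n : X n -> eval X Oracle n 1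
  | eval_oracle_out n : ~ X n -> eval X Oracle n 0
  | eval_pair p q n x y :
      eval X p n x -> eval X q n y -> eval X (Pair p q) n (pr x y)
  | eval_comp p q n m k :
      eval X q n m -> eval X p m k -> eval X (Comp p q) n k
  | eval_prec0 p q a v :
      eval X p a v -> eval X (Prec p q) (pr a 0) v
  | eval_precS p q a n u v :
      eval X (Prec p q) (pr a n) u -> eval X q (pr a (pr n u)) v ->
      eval X (Prec p q) (pr a n.+1) v
  | eval_mu p a n (u : nat -> nat) :
      eval X p (pr a n) 0 ->
      (forall k, k < n -> eval X p (pr a k) (u k).+1) ->
      eval X (Mu p) a n.

Definition computable_from (X : nat -> Prop) (f : nat -> nat) : Prop :=
  exists p, forall n, eval X p n (f n).

Definition no_oracle : nat -> Prop := fun _ => False.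

Definition computable (f : nat -> nat) : Prop := computable_from no_oracle f.

Definition computable_set (P : pred nat) : Prop :=
  computable (fun n => nat_of_bool (P n)).

Fixpoint goedel (p : prog) : nat :=
  match p with
  | Zero => pr 0 0
  | Succ => pr 1 0
  | Fst => pr 2 0
  | Snd => pr 3 0
  | Oracle => pr 4 0
  | Pair p q => pr 5 (pr (goedel p) (goedel q))
  | Comp p q => pr 6 (pr (goedel p) (goedel q))
  | Prec p q => pr 7 (pr (goedel p) (goedel q))
  | Mu p => pr 8 (goedel p)
  end.

(* The [e]-th partial computable function, as a graph; it is nowhere defined
   when [e] is not the number of a program. *)
Definition phi (e n m : nat) : Prop :=
  exists2 p, goedel p = e & eval no_oracle p n m.

Definition ce_index (e : nat) (X : nat -> Prop) : Prop :=
  forall n, X n <-> exists m, phi e n m.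

Definition ce (X : nat -> Prop) : Prop := exists e, ce_index e X.

(* Symbols are identified with their indices; [arity] is meaningful on the
   indices of symbols only. *)
Record language : Type := Language {
  is_rel : pred nat;
  is_fun : pred nat;
  arity : nat -> nat;
  rel_fun_disjoint : forall n, ~~ (is_rel n && is_fun n);
  rel_arity_gt0 : forall n, is_rel n -> 0 < arity n;
  is_rel_computable : computable_set is_rel;
  is_fun_computable : computable_set is_fun;
  arity_computable : computable arity
}.

Definition rsym (L : language) : Type := {n : nat | is_rel L n}.
Definition fsym (L : language) : Type := {n : nat | is_fun L n}.
Definition rar (L : language) (r : rsym L) : nat := arity L (val r).
Definition far (L : language) (f : fsym L) : nat := arity L (val f).

(* The carrier may be empty if the language has no constants. *)
Record structure (L : language) : Type := Structure {
  carrier :> Type;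
  rel_of : forall r : rsym L, (rar r).-tuple carrier -> Prop;
  fun_of : forall f : fsym L, (far f).-tuple carrier -> carrier
}.
Arguments rel_of {L} s r _.
Arguments fun_of {L} s f _.

Definition embedding (L : language) (A B : structure L) (h : A -> B) : Prop :=
  [/\ injective h,
      forall r (x : (rar r).-tuple A),
        rel_of A r x <-> rel_of B r (map_tuple h x)
    & forall f (x : (far f).-tuple A),
        h (fun_of A f x) = fun_of B f (map_tuple h x)].

Definition isomorphic (L : language) (A B : structure L) : Prop :=
  exists2 h : A -> B, embedding h & bijective h.

Definition subuniverse (L : language) (A : structure L) (S : A -> Prop) : Prop :=
  forall f (x : (far f).-tuple A),
    (forall i, S (tnth x i)) -> S (fun_of A f x).

Definition cl (L : language) (A : structure L) (a : seq A) (x : A) : Prop :=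
  forall S : A -> Prop,
    subuniverse S -> (forall y, List.In y a -> S y) -> S x.

Definition generates (L : language) (A : structure L) (a : seq A) : Prop :=
  forall x, cl a x.

Inductive term (L : language) (n : nat) : Type :=
  | Var of 'I_n
  | App (f : fsym L) of ('I_(far f) -> term L n).

Inductive atomic (L : language) (n : nat) : Type :=
  | Eq of term L n & term L n
  | Rel (r : rsym L) of ('I_(rar r) -> term L n).

Fixpoint term_val (L : language) (A : structure L) (n : nat)
    (a : n.-tuple A) (t : term L n) : A :=
  match t with
  | Var i => tnth a i
  | App f ts => fun_of A f [tuple term_val a (ts i) | i < far f]
  end.

Definition sat (L : language) (A : structure L) (n : nat)
    (a : n.-tuple A) (F : atomic L n) : Prop :=
  match F with
  | Eq t u => term_val a t = term_val a u
  | Rel r ts => rel_of A r [tuple term_val a (ts i) | i < rar r]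
  end.

(* Tuples of different lengths are never related. *)
Definition same_atomic_type (L : language) (A B : structure L)
    (a : seq A) (b : seq B) : Prop :=
  exists n (a' : n.-tuple A) (b' : n.-tuple B),
    [/\ a = a', b = b' & forall F : atomic L n, sat a' F <-> sat b' F].

(* Only computable structures are needed, so the underlying set is a boolean
   predicate; this makes the injection of the carrier into [nat] injective. *)
Record nat_structure (L : language) : Type := NatStructure {
  ndom : pred nat;
  nrel : forall r : rsym L, (rar r).-tuple {x : nat | ndom x} -> Prop;
  nfun : forall f : fsym L,
    (far f).-tuple {x : nat | ndom x} -> {x : nat | ndom x}
}.

Coercion structure_of_nat (L : language) (M : nat_structure L) : structure L :=
  Structure (@nrel L M) (@nfun L M).

Definition elt_val (L : language) (M : nat_structure L) (x : M) : nat := sval x.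

Definition code_tuple (L : language) (M : nat_structure L) (a : seq M) : nat :=
  code_seq (map (@elt_val L M) a).

Definition rel_graph (L : language) (M : nat_structure L) (w : nat) : Prop :=
  exists (r : rsym L) (x : (rar r).-tuple M),
    w = pr (val r) (code_tuple x) /\ rel_of M r x.

Definition corel_graph (L : language) (M : nat_structure L) (w : nat) : Prop :=
  exists (r : rsym L) (x : (rar r).-tuple M),
    w = pr (val r) (code_tuple x) /\ ~ rel_of M r x.

Definition fun_graph (L : language) (M : nat_structure L) (w : nat) : Prop :=
  exists (f : fsym L) (x : (far f).-tuple M),
    w = pr (val f) (pr (code_tuple x) (elt_val (fun_of M f x))).

(* An index packs an index of the characteristic function of the underlying
   set with c.e. indices of the relations, their complements and the graphs of
   the functions. *)
Definition structure_index (L : language) (M : nat_structure L) (e : nat) : Prop :=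
  exists eM eR eN eF,
    [/\ e = pr eM (pr eR (pr eN eF)),
        forall x, phi eM x (nat_of_bool (ndom M x)),
        ce_index eR (@rel_graph L M),
        ce_index eN (@corel_graph L M)
      & ce_index eF (@fun_graph L M)].

Record age (L : language) : Type := Age {
  in_age :> structure L -> Prop;
  age_fg : forall A, in_age A -> exists a : seq A, generates a;
  age_iso : forall A B, in_age A -> isomorphic A B -> in_age B
}.

Definition has_AP (L : language) (K : age L) : Prop :=
  forall (A B C : structure L) (fB : A -> B) (fC : A -> C),
    K A -> K B -> K C -> embedding fB -> embedding fC ->
    exists (D : structure L) (gB : B -> D) (gC : C -> D),
      [/\ K D, embedding gB, embedding gC & forall x, gB (fB x) = gC (fC x)].

Definition code_triple (a e i : nat) : nat := pr a (pr e i).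

(* The [i]-th triple consists of [rep_gen i], the structure [rep_str i], given
   by its index [rep_idx i], and [i]. *)
Record computable_age (L : language) (K : age L) : Type := ComputableAge {
  rep_str : nat -> nat_structure L;
  rep_idx : nat -> nat;
  rep_gen : forall i, seq (rep_str i);
  rep_ce : ce (fun w => exists i,
    w = code_triple (code_tuple (rep_gen i)) (rep_idx i) i);
  rep_index : forall i, structure_index (rep_str i) (rep_idx i);
  rep_generates : forall i, generates (rep_gen i);
  rep_in_age : forall i, K (rep_str i);
  rep_onto : forall B : structure L, K B -> exists i, isomorphic B (rep_str i)
}.

Definition code_rep (L : language) (K : age L) (KK : computable_age K)
    (i : nat) : nat :=
  code_triple (code_tuple (rep_gen KK i)) (rep_idx KK i) i.

Definition embedding_information (L : language) (K : age L)
    (KK : computable_age K) (w : nat) : Prop :=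
  exists k0 k1 (b0 : seq (rep_str KK k0)) (b1 : seq (rep_str KK k1)),
    same_atomic_type b0 b1 /\
    w = pr (pr (code_rep KK k0) (code_tuple b0))
           (pr (code_rep KK k1) (code_tuple b1)).

(* The domain and codomain are type indices, so that the equations between
   domains and codomains in spans and diagrams hold by typing.  The length of
   [pe_tuple] is not required to match that of the generating tuple. *)
Record potential_embedding (L : language) (K : age L) (KK : computable_age K)
    (i j : nat) : Type := PotentialEmbedding {
  pe_tuple : seq (rep_str KK j)
}.

Definition code_pe (L : language) (K : age L) (KK : computable_age K)
    (i j : nat) (F : potential_embedding KK i j) : nat :=
  pr (code_rep KK i) (pr (code_rep KK j) (code_tuple (pe_tuple F))).

Definition is_embedding (L : language) (K : age L) (KK : computable_age K)
    (i j : nat) (F : potential_embedding KK i j) : Prop :=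
  same_atomic_type (rep_gen KK i) (pe_tuple F).

(* As the structures are generated by the distinguished tuples, at most one
   [h] satisfies this. *)
Definition encodes (L : language) (K : age L) (KK : computable_age K)
    (i j : nat) (F : potential_embedding KK i j)
    (h : rep_str KK i -> rep_str KK j) : Prop :=
  embedding h /\ map h (rep_gen KK i) = pe_tuple F.

Definition is_span (L : language) (K : age L) (KK : computable_age K)
    (i j0 j1 : nat) (F0 : potential_embedding KK i j0)
    (F1 : potential_embedding KK i j1) : Prop :=
  is_embedding F0 /\ is_embedding F1.

Definition commuting_square (L : language) (K : age L) (KK : computable_age K)
    (i j0 j1 k : nat)
    (F0 : potential_embedding KK i j0) (F1 : potential_embedding KK i j1)
    (G0 : potential_embedding KK j0 k) (G1 : potential_embedding KK j1 k) : Prop :=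
  exists f0 f1 g0 g1,
    [/\ encodes F0 f0, encodes F1 f1, encodes G0 g0, encodes G1 g1
      & forall x, g0 (f0 x) = g1 (f1 x)].

Definition amalgamation_diagram (L : language) (K : age L)
    (KK : computable_age K) (i j0 j1 k : nat)
    (F0 : potential_embedding KK i j0) (F1 : potential_embedding KK i j1)
    (G0 : potential_embedding KK j0 k) (G1 : potential_embedding KK j1 k) : Prop :=
  is_embedding G0 /\
  (is_span F0 F1 -> is_embedding G1 /\ commuting_square F0 F1 G0 G1).

Definition computable_amalgamation_from (X : nat -> Prop) (L : language)
    (K : age L) (KK : computable_age K) : Prop :=
  exists2 f : nat -> nat, computable_from X f &
    forall i j0 j1 (F0 : potential_embedding KK i j0)
      (F1 : potential_embedding KK i j1),
    exists k (G0 : potential_embedding KK j0 k)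
      (G1 : potential_embedding KK j1 k),
      amalgamation_diagram F0 F1 G0 G1 /\
      f (pr (code_pe F0) (code_pe F1)) = pr (code_pe G0) (code_pe G1).

(* Main.v *)
(* An amalgam of a span of embeddings A_i -> A_j0, A_i -> A_j1 with tuples c0, c1
   can be recognised by queries to the embedding information alone: it is given
   by A_k and tuples d0, d1, e such that a_j0 ~ d0, a_j1 ~ d1,
   (a_j0, c0) ~ (d0, e) and (a_j1, c1) ~ (d1, e), since the last two conditions
   say that d0 and d1 encode maps which agree on the image of a_i.  By (AP) an
   unbounded search for such data succeeds on every span.  Whether the input is
   a span is itself decided by the oracle; otherwise the identity of A_j0 and
   the empty tuple form a diagram. *)
Require Import Defs.
From mathcomp Require Import all_boot.
From Stdlib Require Import ClassicalEpsilon.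
From Stdlib Require List Cantor.

Set Implicit Arguments.
Unset Strict Implicit.
Unset Printing Implicit Defensive.

(** * Projections of the pairing function, and list operations on codes *)

Definition p1 (n : nat) : nat := (Cantor.of_nat n).1.
Definition p2 (n : nat) : nat := (Cantor.of_nat n).2.

Lemma p1_pr x y : p1 (pr x y) = x.
Proof. by rewrite /p1 /pr Cantor.cancel_of_to. Qed.

Lemma p2_pr x y : p2 (pr x y) = y.
Proof. by rewrite /p2 /pr Cantor.cancel_of_to. Qed.

Lemma pr_p12 n : pr (p1 n) (p2 n) = n.
Proof. by rewrite /p1 /p2 /pr -surjective_pairing Cantor.cancel_to_of. Qed.

Lemma pr_inj x y x' y' : pr x y = pr x' y' -> x = x' /\ y = y'.
Proof. by move=> e; rewrite -(p1_pr x y) -{2}(p2_pr x y) e p1_pr p2_pr. Qed.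

Lemma leq_pr x y : x + y <= pr x y.
Proof. by rewrite addnC; apply/leP; apply: Cantor.to_nat_non_decreasing. Qed.

Lemma code_seq_inj : injective code_seq.
Proof.
elim=> [|x s IHs] [|y t] //= [] /pr_inj[-> est]; congr (_ :: _).
exact: IHs.
Qed.

(** Strong induction: a nonzero code is the successor of a pair, and a pair is at least each of its
    components, so the code of the tail is strictly smaller. *)
Lemma code_seq_surj n : exists s, code_seq s = n.
Proof.
elim/ltn_ind: n => -[_|n IHn]; first by exists [::].
have [|s es] := IHn (p2 n).
  by rewrite ltnS -{2}(pr_p12 n); apply: leq_trans (leq_pr _ _); apply: leq_addl.
by exists (p1 n :: s); rewrite /= es pr_p12.
Qed.

Lemma size_code_seq s : size s <= code_seq s.
Proof.
elim: s => //= x s IHs; rewrite ltnS.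
by apply: leq_trans (leq_pr _ _); apply: leq_trans IHs (leq_addl _ _).
Qed.

(** One step of a loop whose state pairs the code of the list still to be read with the code of the
    accumulator; the head of the former is pushed onto the latter. *)
Definition catrev_step (w : nat) : nat :=
  if p1 w == 0 then w
  else pr (p2 (p1 w).-1) (pr (p1 (p1 w).-1) (p2 w)).+1.

Definition code_catrev (u v : nat) : nat := p2 (iter u catrev_step (pr u v)).

(* The number of iterations [code_seq s] may exceed the length of [s], but
   [catrev_step] is stationary once the first list is exhausted. *)
Lemma code_catrevE s t :
  code_catrev (code_seq s) (code_seq t) = code_seq (catrev s t).
Proof.
rewrite /code_catrev.
suff H n : size s <= n ->
    p2 (iter n catrev_step (pr (code_seq s) (code_seq t))) = code_seq (catrev s t).
  exact: H (size_code_seq s).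
elim: n s t => [|n IHn] [|x s] t //= hs; rewrite ?p2_pr // -iterS iterSr.
  rewrite /catrev_step p1_pr /=; exact: (IHn [::]).
by rewrite {2}/catrev_step p1_pr /= p1_pr !p2_pr; apply: (IHn s (x :: t)).
Qed.

(** Concatenation as two reversals, so that iteration of a single step suffices for its
    computability. *)
Definition code_cat (u v : nat) : nat := code_catrev (code_catrev u 0) v.

Lemma code_catE s t : code_cat (code_seq s) (code_seq t) = code_seq (s ++ t).
Proof.
by rewrite /code_cat (code_catrevE s [::]) code_catrevE [catrev s _]catrevE cats0
           catrevE revK.
Qed.

(** A classical truth value, so that oracle answers can be combined as booleans. *)
Definition mem_oracle (X : nat -> Prop) (n : nat) : bool :=
  if excluded_middle_informative (X n) then true else false.

Lemma mem_oracleP (X : nat -> Prop) n : reflect (X n) (mem_oracle X n).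
Proof.
by rewrite /mem_oracle; case: excluded_middle_informative => h; constructor.
Qed.

(** * Closure properties of the functions computable from an oracle *)

Section Computability.
Variable X : nat -> Prop.
Local Notation cf := (computable_from X).

Lemma cf_ext f g : f =1 g -> cf f -> cf g.
Proof. by move=> efg [p hp]; exists p => n; rewrite -efg. Qed.

Lemma cf_comp f g : cf f -> cf g -> cf (fun n => f (g n)).
Proof.
by move=> [p hp] [q hq]; exists (Comp p q) => n; apply: eval_comp (hq n) (hp _).
Qed.

Lemma cf_pr f g : cf f -> cf g -> cf (fun n => pr (f n) (g n)).
Proof.
by move=> [p hp] [q hq]; exists (Pair p q) => n; apply: eval_pair.
Qed.

Lemma cf_p1 f : cf f -> cf (fun n => p1 (f n)).
Proof.
apply: cf_comp; exists Fst => n.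
by rewrite -{1}(pr_p12 n); apply: eval_fst.
Qed.

Lemma cf_p2 f : cf f -> cf (fun n => p2 (f n)).
Proof.
apply: cf_comp; exists Snd => n.
by rewrite -{1}(pr_p12 n); apply: eval_snd.
Qed.

(** The programs have no primitive identity; pairing the two projections gives it, since every
    number is a pair. *)
Lemma cf_id : cf (fun n => n).
Proof.
apply: (@cf_ext (fun n => pr (p1 n) (p2 n))) => [n|]; first exact: pr_p12.
apply: cf_pr.
  by exists Fst => n; rewrite -{1}(pr_p12 n); apply: eval_fst.
by exists Snd => n; rewrite -{1}(pr_p12 n); apply: eval_snd.
Qed.

Lemma cf_succ f : cf f -> cf (fun n => (f n).+1).
Proof. by apply: cf_comp; exists Succ => n; apply: eval_succ. Qed.

Lemma cf_zero : cf (fun=> 0).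
Proof. by exists Zero => n; apply: eval_zero. Qed.

Lemma cf_mem f : cf f -> cf (fun n => mem_oracle X (f n)).
Proof.
apply: (@cf_comp (fun n => mem_oracle X n)); exists Oracle => n.
case: mem_oracleP => h; [exact: eval_oracle_in | exact: eval_oracle_out].
Qed.

Lemma cf_prec (r : nat -> nat -> nat) g h k f :
    (forall a, r a 0 = g a) ->
    (forall a n, r a n.+1 = h (pr a (pr n (r a n)))) ->
  cf g -> cf h -> cf k -> cf f -> cf (fun n => r (f n) (k n)).
Proof.
move=> r0 rS [p hp] [q hq] cfk cff.
suff cfr: cf (fun n => r (p1 n) (p2 n)).
  apply: (@cf_ext (fun n => r (p1 (pr (f n) (k n))) (p2 (pr (f n) (k n))))).
    by move=> n; rewrite p1_pr p2_pr.
  exact: (cf_comp cfr (cf_pr cff cfk)).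
exists (Prec p q) => n; rewrite -{1}(pr_p12 n); move: (p1 n) (p2 n) => a.
elim=> [|m IHm]; first by rewrite r0; apply: eval_prec0.
by rewrite rS; apply: eval_precS IHm (hq _).
Qed.

Lemma cf_iter s k f :
  cf s -> cf k -> cf f -> cf (fun n => iter (k n) s (f n)).
Proof.
move=> cfs; apply: (@cf_prec (fun a n => iter n s a) id (fun w => s (p2 (p2 w)))).
- by [].
- by move=> a n /=; rewrite !p2_pr.
- exact: cf_id.
- by apply: cf_comp cfs _; do 2!apply: cf_p2; apply: cf_id.
Qed.

Lemma cf_pred f : cf f -> cf (fun n => (f n).-1).
Proof.
move=> cff.
apply: (@cf_prec (fun _ n => n.-1) (fun=> 0) (fun w => p1 (p2 w)) f (fun=> 0)) => //.
- by move=> a n; rewrite p2_pr p1_pr.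
- exact: cf_zero.
- by apply: cf_p1; apply: cf_p2; apply: cf_id.
- exact: cf_zero.
Qed.

(** Recursion on the truth value as a number: the base case is the else branch, and the successor
    step ignores the previous value and returns the then branch. *)
Lemma cf_if (b : nat -> bool) f g :
  cf b -> cf f -> cf g -> cf (fun n => if b n then f n else g n).
Proof.
move=> cfb cff cfg.
apply: (@cf_ext (fun n => if b n : nat is _.+1 then f n else g n)) => [n|].
  by case: (b n).
apply: (@cf_prec (fun a m => if m is _.+1 then f a else g a) g (fun w => f (p1 w))
          (fun n => b n) (fun n => n)) => // [a n||].
- by rewrite p1_pr.
- by apply: cf_comp cff _; apply: cf_p1 cf_id.
- exact: cf_id.
Qed.

Lemma cf_eq0 f : cf f -> cf (fun n => f n == 0).
Proof.
move=> cff.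
apply: (@cf_prec (fun _ n => n == 0) (fun=> 1) (fun=> 0) f (fun=> 0)) => //.
- exact: cf_succ cf_zero.
- exact: cf_zero.
- exact: cf_zero.
Qed.

Lemma cf_andb (b c : nat -> bool) : cf b -> cf c -> cf (fun n => b n && c n).
Proof.
move=> cfb cfc; apply: cf_ext (cf_if cfb cfc cf_zero) => n.
by case: (b n).
Qed.

Lemma cf_implyb (b c : nat -> bool) : cf b -> cf c -> cf (fun n => b n ==> c n).
Proof.
move=> cfb cfc; apply: cf_ext (cf_if cfb cfc (cf_succ cf_zero)) => n.
by case: (b n).
Qed.

Lemma cf_code_cat f g : cf f -> cf g -> cf (fun n => code_cat (f n) (g n)).
Proof.
have cf_catrev u v : cf u -> cf v -> cf (fun n => code_catrev (u n) (v n)).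
  move=> cfu cfv; apply: cf_p2; apply: cf_iter (cfu) (cf_pr cfu cfv).
  have cfp := cf_p1 cf_id; have cfp' := cf_pred cfp.
  apply: cf_if (cf_eq0 cfp) cf_id _.
  apply: cf_pr (cf_p2 cfp') _; apply: cf_succ.
  exact: cf_pr (cf_p1 cfp') (cf_p2 cf_id).
by move=> cff cfg; apply: (cf_catrev _ _ (cf_catrev _ _ cff cf_zero) cfg).
Qed.

Lemma cf_search (b : nat -> bool) :
    cf b -> (forall a, exists m, b (pr a m)) ->
  exists2 g, cf g & forall a, b (pr a (g a)).
Proof.
move=> cfb exb; exists (fun a => ex_minn (exb a)) => [|a]; last by case: ex_minnP.
(* [Mu] looks for the first zero, so [p] returns 0 where [b] holds and 1 elsewhere. *)
have [p hp] := cf_if cfb cf_zero (cf_succ cf_zero).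
exists (Mu p) => a; case: ex_minnP => m bm min_m.
apply: (@eval_mu _ _ _ _ (fun=> 0)) => [|k lt_km].
  by have := hp (pr a m); rewrite bm.
have := hp (pr a k); case: ifP => // bk.
by move: lt_km; rewrite ltnNge min_m.
Qed.

End Computability.

(** * Atomic types of tuples and the embeddings they determine *)

Section AtomicTypes.
Variable L : language.

Lemma In_tnth (T : Type) n (a : n.-tuple T) x :
  List.In x a -> exists i, tnth a i = x.
Proof.
case: a => s hs /= xs.
have [m [lt_m <-]] := List.In_nth s x x xs.
have eq_nth u j : List.nth j u x = nth x u j by elim: u j => [|y u IHu] [|j] /=.
have lt_mn : m < n by rewrite -(eqP hs); apply/ltP.
by exists (Ordinal lt_mn); rewrite (tnth_nth x) eq_nth.
Qed.

(** The values of terms at [a] form a subuniverse containing [a]. *)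
Lemma generated_term (A : structure L) n (a : n.-tuple A) :
  generates a -> forall x : A, exists t : term L n, term_val a t = x.
Proof.
move=> gen_a x; apply: (gen_a x (fun y => exists t, term_val a t = y)); last first.
  by move=> y ya; have [i <-] := In_tnth ya; exists (Var L i).
move=> f y hy.
pose ts i := proj1_sig (constructive_indefinite_description _ (hy i)).
have tsE i : term_val a (ts i) = tnth y i.
  by rewrite /ts; case: constructive_indefinite_description.
exists (App ts) => /=; congr fun_of; apply: eq_from_tnth => i.
by rewrite tnth_mktuple.
Qed.

Lemma term_val_embedding (A B : structure L) (h : A -> B) n (a : n.-tuple A) t :
  embedding h -> term_val (map_tuple h a) t = h (term_val a t).
Proof.
case=> _ _ hF; elim: t => [i|f ts IH] /=; first by rewrite tnth_map.
rewrite hF; congr fun_of; apply: eq_from_tnth => i.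
by rewrite tnth_mktuple tnth_map tnth_mktuple IH.
Qed.

Lemma same_atomic_type_map (A B : structure L) (h : A -> B) (s : seq A) :
  embedding h -> same_atomic_type s (map h s).
Proof.
move=> eh; exists (size s), (in_tuple s), (map_tuple h (in_tuple s)); split=> //.
have [hI hR _] := eh.
case=> [t u | r ts] /=; first by rewrite !term_val_embedding //; split=> [->|/hI].
rewrite hR; suff -> : map_tuple h [tuple term_val (in_tuple s) (ts i) | i < rar r]
    = [tuple term_val (map_tuple h (in_tuple s)) (ts i) | i < rar r] by [].
apply: eq_from_tnth => i.
by rewrite tnth_map !tnth_mktuple term_val_embedding.
Qed.

(** Every element of [A] is the value of some term at [a]; the embedding sends it to the value of a
    chosen such term at [b]. *)
Lemma same_atomic_type_embedding (A B : structure L) (a : seq A) (b : seq B) :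
    generates a -> same_atomic_type a b ->
  exists2 h : A -> B, embedding h & map h a = b.
Proof.
move=> gen_a [n [a' [b' [ea eb hab]]]]; subst a b.
pose T x := proj1_sig (constructive_indefinite_description _ (generated_term gen_a x)).
have TE x : term_val a' (T x) = x.
  by rewrite /T; case: constructive_indefinite_description.
(* Left to right, this makes the value in [B] independent of the chosen term; right to left, it
   gives injectivity. *)
have eqT t u : term_val a' t = term_val a' u <-> term_val b' t = term_val b' u.
  exact: (hab (Eq t u)).
exists (fun x => term_val b' (T x)); last first.
  suff eb : map_tuple (fun x => term_val b' (T x)) a' = b'.
    exact: (congr1 (@tval n B) eb).
  apply: eq_from_tnth => i; rewrite tnth_map.
  by apply/(eqT (T (tnth a' i)) (Var L i)); rewrite TE.
split=> [x y /eqT | r x | f x]; first by rewrite !TE.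
  have := hab (Rel (fun i => T (tnth x i))); rewrite /sat.
  have -> : [tuple term_val a' (T (tnth x i)) | i < rar r] = x.
    by apply: eq_from_tnth => i; rewrite tnth_mktuple TE.
  suff -> : [tuple term_val b' (T (tnth x i)) | i < rar r]
      = map_tuple (fun x => term_val b' (T x)) x by [].
  by apply: eq_from_tnth => i; rewrite tnth_mktuple tnth_map.
(* The term chosen for the value of [f] and [f] applied to the terms chosen for its arguments agree
   in [A], hence in [B]. *)
transitivity (term_val b' (App (fun i => T (tnth x i)))).
  apply/eqT; rewrite TE /=; congr fun_of.
  by apply: eq_from_tnth => i; rewrite tnth_mktuple TE.
rewrite /=; congr fun_of.
by apply: eq_from_tnth => i; rewrite tnth_mktuple tnth_map.
Qed.

Lemma generates_cat (A : structure L) (a c : seq A) :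
  generates a -> generates (a ++ c).
Proof.
move=> gen_a x S sub_S S_ac; apply: gen_a => // y ya.
by apply: S_ac; apply/List.in_app_iff; left.
Qed.

Lemma same_atomic_type_size (A B : structure L) (a : seq A) (b : seq B) :
  same_atomic_type a b -> size a = size b.
Proof. by case=> n [a' [b' [-> -> _]]]; rewrite !size_tuple. Qed.

Lemma same_atomic_type_refl (A : structure L) (a : seq A) :
  same_atomic_type a a.
Proof. by exists (size a), (in_tuple a), (in_tuple a). Qed.

Lemma embedding_comp (A B C : structure L) (g : B -> C) (h : A -> B) :
  embedding g -> embedding h -> embedding (fun x => g (h x)).
Proof.
have map2 n (x : n.-tuple A) :
    map_tuple (fun y => g (h y)) x = map_tuple g (map_tuple h x).
  by apply: eq_from_tnth => i; rewrite !tnth_map.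
move=> [gI gR gF] [hI hR hF]; split=> [x y /gI/hI // | r x | f x].
  by rewrite map2 -gR -hR.
by rewrite map2 -gF -hF.
Qed.

(** The points where [g] and [h] agree form a subuniverse containing the generators. *)
Lemma eq_embedding (A B : structure L) (g h : A -> B) (a : seq A) :
    generates a -> embedding g -> embedding h -> map g a = map h a ->
  g =1 h.
Proof.
move=> gen_a [_ _ gF] [_ _ hF] egh x; apply: (gen_a x (fun y => g y = h y)).
  move=> f y egy; rewrite gF hF; congr fun_of.
  by apply: eq_from_tnth => i; rewrite !tnth_map.
elim: a egh {gen_a} => [|z a IHa] //= [egz /IHa{}IHa] y [<- // | /IHa //].
Qed.

End AtomicTypes.

(** * Recognition of spans and amalgams by queries to the embedding information *)

Section Amalgamation.
Variables (L : language) (K : age L) (KK : computable_age K).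

Lemma code_tuple_inj (M : nat_structure L) : injective (@code_tuple L M).
Proof. by move=> s t /code_seq_inj; apply: inj_map; apply: val_inj. Qed.

Lemma code_cat_tuple (M : nat_structure L) (s t : seq M) :
  code_cat (code_tuple s) (code_tuple t) = code_tuple (s ++ t).
Proof. by rewrite /code_tuple code_catE map_cat. Qed.

(** Here [u] and [v] are arbitrary numbers, as met in an unbounded search. Each codes some list of
    numbers, and cutting [s] at the length of the first list shows that both lists lie in [M]. *)
Lemma code_tuple_cat_inv (M : nat_structure L) (s : seq M) u v :
    code_tuple s = code_cat u v ->
  exists s1 s2, [/\ s = s1 ++ s2, u = code_tuple s1 & v = code_tuple s2].
Proof.
have [u' <-] := code_seq_surj u; have [v' <-] := code_seq_surj v.
rewrite code_catE => /code_seq_inj es.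
exists (take (size u') s), (drop (size u') s); rewrite cat_take_drop /code_tuple.
by rewrite map_take map_drop es take_size_cat // drop_size_cat.
Qed.

Lemma code_rep_inj : injective (code_rep KK).
Proof. by move=> i j /pr_inj[_] /pr_inj[]. Qed.

Lemma p1_code_rep i : p1 (code_rep KK i) = code_tuple (rep_gen KK i).
Proof. exact: p1_pr. Qed.

Definition ei_query (r0 s0 r1 s1 : nat) : bool :=
  mem_oracle (embedding_information KK) (pr (pr r0 s0) (pr r1 s1)).

(** A positive answer certifies that the four numbers code genuine triples and tuples, so the tests
    need no separate check of well-formedness. *)
Lemma ei_query_inv r0 s0 r1 s1 : ei_query r0 s0 r1 s1 ->
  exists k0 k1 (b0 : seq (rep_str KK k0)) (b1 : seq (rep_str KK k1)),
    [/\ r0 = code_rep KK k0, s0 = code_tuple b0, r1 = code_rep KK k1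
      & s1 = code_tuple b1] /\ same_atomic_type b0 b1.
Proof.
move/mem_oracleP=> [k0 [k1 [b0 [b1 [h]]]]].
by case/pr_inj=> /pr_inj[-> ->] /pr_inj[-> ->]; exists k0, k1, b0, b1.
Qed.

Lemma ei_queryP k0 k1 (b0 : seq (rep_str KK k0)) (b1 : seq (rep_str KK k1)) :
  reflect (same_atomic_type b0 b1)
    (ei_query (code_rep KK k0) (code_tuple b0) (code_rep KK k1) (code_tuple b1)).
Proof.
apply: (iffP idP) => [/ei_query_inv | h]; last first.
  by apply/mem_oracleP; exists k0, k1, b0, b1.
case=> l0 [l1 [c0 [c1 [[/code_rep_inj e0 + /code_rep_inj e1 +]]]]].
by subst l0 l1 => /code_tuple_inj-> /code_tuple_inj->.
Qed.

Lemma ei_query_tuple k0 (b0 : seq (rep_str KK k0)) r1 s1 :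
    ei_query (code_rep KK k0) (code_tuple b0) r1 s1 ->
  exists k1 (b1 : seq (rep_str KK k1)),
    [/\ r1 = code_rep KK k1, s1 = code_tuple b1 & same_atomic_type b0 b1].
Proof.
move=> h; have [_ [k1 [_ [b1 [[_ _ er1 es1] _]]]]] := ei_query_inv h.
(* Inversion yields a fresh index on the left. Once the right side is known to be a code, asking the
   same query again relates [b0] itself to [b1]. *)
by subst r1 s1; exists k1, b1; split=> //; apply/ei_queryP.
Qed.

Lemma cf_ei_query r0 s0 r1 s1 :
    let cf := computable_from (embedding_information KK) in
    cf r0 -> cf s0 -> cf r1 -> cf s1 ->
  cf (fun n => ei_query (r0 n) (s0 n) (r1 n) (s1 n)).
Proof.
by move=> cf cfr0 cfs0 cfr1 cfs1; apply: cf_mem; apply: cf_pr; apply: cf_pr.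
Qed.

(** The domain is read from the first potential embedding only; in the code of a potential span the
    second has the same one. The generating tuple is the first component of the code of a triple. *)
Definition span_test (n : nat) : bool :=
  let u := p1 n in let v := p2 n in
  ei_query (p1 u) (p1 (p1 u)) (p1 (p2 u)) (p2 (p2 u)) &&
  ei_query (p1 u) (p1 (p1 u)) (p1 (p2 v)) (p2 (p2 v)).

(* Here [n] codes two potential embeddings with tuples [c0], [c1], and [m] codes
   [(r, (e, (d0, d1)))]. *)
Definition amalgam_test (n m : nat) : bool :=
  let r := p1 m in let e := p1 (p2 m) in
  let d0 := p1 (p2 (p2 m)) in let d1 := p2 (p2 (p2 m)) in
  let r0 := p1 (p2 (p1 n)) in let c0 := p2 (p2 (p1 n)) in
  let r1 := p1 (p2 (p2 n)) in let c1 := p2 (p2 (p2 n)) in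
  [&& ei_query r0 (p1 r0) r d0, ei_query r1 (p1 r1) r d1,
      ei_query r0 (code_cat (p1 r0) c0) r (code_cat d0 e)
    & ei_query r1 (code_cat (p1 r1) c1) r (code_cat d1 e)].

(** The component [e] of the witness only certifies commutation and is dropped. In the else branch,
    [p1 r0] codes the generating tuple, giving the identity, and 0 codes the empty tuple. *)
Definition diagram_of (n m : nat) : nat :=
  let r := p1 m in
  let r0 := p1 (p2 (p1 n)) in let r1 := p1 (p2 (p2 n)) in
  if span_test n
  then pr (pr r0 (pr r (p1 (p2 (p2 m))))) (pr r1 (pr r (p2 (p2 (p2 m)))))
  else pr (pr r0 (pr r0 (p1 r0))) (pr r1 (pr r0 0)).

Ltac cf_tac :=
  repeat first
    [ assumption | exact: cf_id | exact: cf_zero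
    | apply: cf_ei_query | apply: cf_andb | apply: cf_implyb | apply: cf_if
    | apply: cf_code_cat | apply: cf_pr | apply: cf_p1 | apply: cf_p2 ].

Lemma cf_span_test f :
    let cf := computable_from (embedding_information KK) in
  cf f -> cf (fun n => span_test (f n)).
Proof. by move=> cf cff; rewrite /span_test; cf_tac. Qed.

Lemma cf_amalgam_test f g :
    let cf := computable_from (embedding_information KK) in
  cf f -> cf g -> cf (fun n => amalgam_test (f n) (g n)).
Proof. by move=> cf cff cfg; rewrite /amalgam_test; cf_tac. Qed.

Lemma cf_diagram_of f g :
    let cf := computable_from (embedding_information KK) in
  cf f -> cf g -> cf (fun n => diagram_of (f n) (g n)).
Proof.
move=> cf cff cfg; rewrite /diagram_of; apply: cf_if; last by cf_tac.
  exact: cf_span_test.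
by cf_tac.
Qed.

(** Stated for every number [n], because the search must halt on all inputs. The domain recorded in
    the second component is unconstrained, so only the second projections are recovered. *)
Lemma span_test_inv n : span_test n ->
  exists i j0 j1 (F0 : potential_embedding KK i j0)
    (F1 : potential_embedding KK i j1),
    [/\ p2 (p1 n) = p2 (code_pe F0), p2 (p2 n) = p2 (code_pe F1) & is_span F0 F1].
Proof.
rewrite /span_test -(pr_p12 (p2 (p1 n))) -(pr_p12 (p2 (p2 n))) !p1_pr !p2_pr.
move=> /andP[h0 h1].
have [i [_ [_ [_ [[er _ _ _] _]]]]] := ei_query_inv h0.
rewrite er p1_code_rep in h0 h1.
have [j0 [c0 [-> -> s0]]] := ei_query_tuple h0.
have [j1 [c1 [-> -> s1]]] := ei_query_tuple h1.
exists i, j0, j1, (@PotentialEmbedding _ _ KK i j0 c0).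
by exists (@PotentialEmbedding _ _ KK i j1 c1); rewrite !p2_pr.
Qed.

Lemma span_testP i j0 j1 (F0 : potential_embedding KK i j0)
    (F1 : potential_embedding KK i j1) :
  reflect (is_span F0 F1) (span_test (pr (code_pe F0) (code_pe F1))).
Proof.
rewrite /span_test /code_pe !(p1_pr, p2_pr).
apply: (iffP andP) => -[h0 h1].
  by split; apply/ei_queryP.
by split; apply/ei_queryP.
Qed.

Lemma amalgam_test_exists (hAP : has_AP K) n :
  span_test n -> exists m, amalgam_test n m.
Proof.
case/span_test_inv=> i [j0 [j1 [[c0] [[c1] [en0 en1 [h0 h1]]]]]].
rewrite /amalgam_test en0 en1 /code_pe !(p1_pr, p2_pr) !code_cat_tuple.
have gen := @rep_generates _ _ KK.
have [f0 ef0 ac0] := same_atomic_type_embedding (gen i) h0; simpl in ac0.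
have [f1 ef1 ac1] := same_atomic_type_embedding (gen i) h1; simpl in ac1.
have Kin := rep_in_age KK.
have [D [g0 [g1 [KD eg0 eg1 g01]]]] := hAP _ _ _ _ _ (Kin i) (Kin j0) (Kin j1) ef0 ef1.
(* The amalgam [D] is an abstract member of the age; [h] moves it to a structure of the
   representation. *)
have [k [h eh _]] := rep_onto KK KD.
have eh0 := embedding_comp eh eg0; have eh1 := embedding_comp eh eg1.
pose d0 := map (fun x => h (g0 x)) (rep_gen KK j0).
pose d1 := map (fun x => h (g1 x)) (rep_gen KK j1).
(* The image of the generators of the domain under the common composite, hence the image of both
   [c0] and [c1]. *)
pose e := map (fun x => h (g0 (f0 x))) (rep_gen KK i).
have e0 : e = map (fun x => h (g0 x)) c0 by rewrite -ac0 -map_comp.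
have e1 : e = map (fun x => h (g1 x)) c1.
  by rewrite -ac1 -map_comp /e; apply: eq_map => x /=; rewrite g01.
exists (pr (code_rep KK k) (pr (code_tuple e) (pr (code_tuple d0) (code_tuple d1)))).
rewrite !(p1_pr, p2_pr) !code_cat_tuple; apply/and4P; split; apply/ei_queryP.
- exact: same_atomic_type_map eh0.
- exact: same_atomic_type_map eh1.
- by rewrite e0 -map_cat; apply: same_atomic_type_map eh0.
- by rewrite e1 -map_cat; apply: same_atomic_type_map eh1.
Qed.

(** The concatenated tuple still generates, so the query yields an embedding. As [d] is as long as
    the generating tuple, the image splits at the right place: generators go to [d], and [c] to the
    tuple coded by [e]. *)
Lemma ei_query_extension j k (c : seq (rep_str KK j)) (d : seq (rep_str KK k)) e :
    same_atomic_type (rep_gen KK j) d ->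
    ei_query (code_rep KK j) (code_tuple (rep_gen KK j ++ c)) (code_rep KK k)
      (code_cat (code_tuple d) e) ->
  exists2 g : rep_str KK j -> rep_str KK k,
    embedding g /\ map g (rep_gen KK j) = d & code_tuple (map g c) = e.
Proof.
move=> sd h; have [k' [b [/code_rep_inj ek eb sb]]] := ei_query_tuple h.
subst k'; have [d' [e' [? /code_tuple_inj ? ?]]] := code_tuple_cat_inv (esym eb).
subst b d' e.
have gen := generates_cat (c := c) (@rep_generates _ _ KK j).
have [g eg] := same_atomic_type_embedding gen sb.
rewrite map_cat => /eqP; rewrite eqseq_cat; last first.
  by rewrite size_map (same_atomic_type_size sd).
by case/andP=> /eqP gd /eqP ge; exists g; rewrite ?ge.
Qed.

Lemma amalgam_test_sound i j0 j1 (F0 : potential_embedding KK i j0)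
    (F1 : potential_embedding KK i j1) (n := pr (code_pe F0) (code_pe F1)) m :
    is_span F0 F1 -> amalgam_test n m ->
  exists k (G0 : potential_embedding KK j0 k) (G1 : potential_embedding KK j1 k),
    amalgamation_diagram F0 F1 G0 G1 /\ diagram_of n m = pr (code_pe G0) (code_pe G1).
Proof.
move=> sp; have [h0 h1] := sp.
have -> : diagram_of n m = pr (pr (code_rep KK j0) (pr (p1 m) (p1 (p2 (p2 m)))))
                              (pr (code_rep KK j1) (pr (p1 m) (p2 (p2 (p2 m))))).
  by rewrite /diagram_of (introT (span_testP _ _) sp) /n /code_pe !(p1_pr, p2_pr).
rewrite /amalgam_test /n /code_pe !(p1_pr, p2_pr) !code_cat_tuple.
case/and4P=> q0 q1 q2 q3.
have [k [d0 [er ed0 s0]]] := ei_query_tuple q0.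
rewrite er in q1 q2 q3 *; rewrite ed0 in q2 *.
have [k' [d1 [/code_rep_inj ek ed1 s1]]] := ei_query_tuple q1.
subst k'; rewrite ed1 in q3 *.
have [g0 [eg0 gd0] ge0] := ei_query_extension s0 q2.
have [g1 [eg1 gd1] ge1] := ei_query_extension s1 q3.
have [f0 ef0 fc0] := same_atomic_type_embedding (@rep_generates _ _ KK i) h0.
have [f1 ef1 fc1] := same_atomic_type_embedding (@rep_generates _ _ KK i) h1.
exists k, (@PotentialEmbedding _ _ KK j0 k d0), (@PotentialEmbedding _ _ KK j1 k d1).
split=> //; split=> // _; split=> //; exists f0, f1, g0, g1; split=> //.
apply: (eq_embedding (@rep_generates _ _ KK i)).
- exact: embedding_comp.
- exact: embedding_comp.
(* Both composites send the generators to the tuple coded by the component [e] of the witness. *)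
- apply: code_tuple_inj; rewrite (map_comp g0 f0) (map_comp g1 f1) fc0 fc1.
  by rewrite ge0 ge1.
Qed.

End Amalgamation.

Theorem proposition5p25 (L : language) (K : age L) (KK : computable_age K)
    (hAP : has_AP K) :
  computable_amalgamation_from (embedding_information KK) KK.
Proof.
set X := embedding_information KK.
(* The implication makes the search succeed at once on inputs that fail the span test, so that [g]
   is total. *)
have [|a|g cfg hg] := @cf_search X
    (fun w => span_test KK (p1 w) ==> amalgam_test KK (p1 w) (p2 w)).
- have [c1 c2] := (cf_p1 (cf_id X), cf_p2 (cf_id X)).
  by apply: cf_implyb; [apply: cf_span_test | apply: cf_amalgam_test].
- have [/(amalgam_test_exists hAP)[m hm]|nsp] := boolP (span_test KK a).
    by exists m; rewrite /= !(p1_pr, p2_pr) hm implybT.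
  by exists 0; rewrite p1_pr (negPf nsp).
exists (fun n => diagram_of KK n (g n)); first exact: cf_diagram_of (cf_id X) cfg.
move=> i j0 j1 F0 F1; set n := pr _ _.
have := hg n; rewrite p1_pr p2_pr.
have [sp hn|nsp _] := span_testP F0 F1; first exact: amalgam_test_sound.
(* Not a span: only the first map has to be an embedding, and the identity is one. *)
exists j0, (@PotentialEmbedding _ _ KK j0 j0 (rep_gen KK j0)).
exists (@PotentialEmbedding _ _ KK j1 j0 [::]); split.
  by split=> //; apply: same_atomic_type_refl.
rewrite /diagram_of (introF (span_testP _ _) nsp) /n /code_pe.
by rewrite !(p1_pr, p2_pr).
Qed.
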